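(* Let $(C,\langle\cdot\rangle,\{\mathfrak m_{k,\beta}\})$ be a $G$-gapped cyclic filtered $A_\infty$ algebra of dimension $3$ with $G\subset\mathbb R_{\ge0}$. If $t\mapsto b(t)\in\widetilde{\mathcal M}(C;\Lambda_+)$, $t\in[0,1]$, is a $C^1$ map, then $\Psi'(b(0))=\Psi'(b(1))$.
   Context: $\Lambda_0=\{\sum_i a_iT^{\lambda_i}: a_i\in\mathbb R,\ \lambda_i\ge0,\ \lambda_i\to+\infty\}$ and $\Lambda_+\subset\Lambda_0$ is the ideal with all exponents $>0$. $G\subset\mathbb R_{\ge0}$ is a discrete submonoid and $E(\beta)\in\mathbb R_{\ge 0}$ denotes $\beta\in G$ as a real number. A $G$-gapped cyclic filtered $A_\infty$ algebra of dimension $3$ is a graded real vector space $\overline C$ (finite dimensional, or the de Rham complex of a closed oriented $3$-manifold), with $\deg'x=\deg x-1$ the degree in $\overline C[1]$, a pairing $\langle\cdot,\cdot\rangle:\overline C^i\otimes\overline C^{3-i}\to\mathbb R$ with $\langle x,y\rangle=(-1)^{1+\deg'x\deg'y}\langle y,x\rangle$, and operations $\mathfrak m_{k,\beta}:\overline C[1]^{\otimes k}\to\overline C[1]$ ($k\ge0$, $\beta\in G$) of degree $1$ with $\mathfrak m_{0,0}=0$, such that $\sum_{k_1+k_2=k+1}\sum_{\beta_1+\beta_2=\beta}\sum_i(-1)^{\deg'x_1+\dots+\deg'x_{i-1}}\mathfrak m_{k_1,\beta_1}(x_1,\dots,\mathfrak m_{k_2,\beta_2}(x_i,\dots),\dots,x_k)=0$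 and $\langle\mathfrak m_{k,\beta}(x_1,\dots,x_k),x_0\rangle=(-1)^{\deg'x_0(\deg'x_1+\dots+\deg'x_k)}\langle\mathfrak m_{k,\beta}(x_0,x_1,\dots,x_{k-1}),x_k\rangle$. $C_+=\overline C\otimes\Lambda_+$ ($T$-adically completed); operations are extended $\Lambda_0$-linearly. $\widetilde{\mathcal M}(C;\Lambda_+)$ is the set of $b\in C_+^1$ with $\sum_{k\ge0}\sum_{\beta\in G}T^{E(\beta)}\mathfrak m_{k,\beta}(b,\dots,b)=0$. For $b\in C^1_+$, $\Psi'(b)=\sum_{k\ge0}\sum_{\beta\in G}\frac{T^{E(\beta)}}{k+1}\langle\mathfrak m_{k,\beta}(b,\dots,b),b\rangle\in\Lambda_0$. A $C^1$ map means $b(t)=\sum_iT^{\lambda_i}b_i(t)$ with $0<\lambda_i\to\infty$ independent of $t$ and $b_i(t)\in\overline C^1$ of class $C^1$ in $t$.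
   Formalization: When C is the de Rham complex, the operations m_{k,β} and the pairing are additionally assumed continuous for the C^∞ topology; without this the claim fails for discontinuous operations. *)

(* Defs.v *)
From HB Require Import structures.
From mathcomp Require Import all_boot all_order all_algebra.
From mathcomp Require Import all_classical all_reals all_analysis.

Set Implicit Arguments.
Unset Strict Implicit.
Unset Printing Implicit Defensive.

Import Order.TTheory GRing.Theory Num.Theory.
Import numFieldNormedType.Exports.

Local Open Scope classical_set_scope.
Local Open Scope ring_scope.

(* Discreteness means that there are finitely many elements below each energy
   level, so that sums over G converge T-adically. *)
Definition discrete_submonoid (R : realType) (G : set R) : Prop :=
  [/\ G 0,
      forall x y, G x -> G y -> G (x + y),
      forall x, G x -> 0 <= x &
      forall e, finite_set [set x | G x /\ x <= e]].

Definition is_grading (R : realType) (V : lmodType R) (gr : int -> set V) : Prop :=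
  (forall d, gr d 0 /\ forall (a : R) x y, gr d x -> gr d y -> gr d (a *: x + y)) /\
  (forall v : V, exists! x : int -> V,
     [/\ forall d, gr d (x d),
         finite_set [set d | x d != 0] &
         v = \sum_(d \in [set: int]) x d]).

(** ** Finite dimensional spaces, with their standard topology *)

Definition finite_dimensional (R : realType) (V : tvsType R) : Prop :=
  exists (n : nat) (f : 'rV[R]_n -> V) (g : V -> 'rV[R]_n),
    [/\ linear f, cancel f g, cancel g f, continuous f & continuous g].

(** ** The de Rham complex of a closed oriented 3-manifold *)

Definition iter_derive (R : realType) (W : normedModType R)
    (us : seq 'rV[R]_3) (f : 'rV[R]_3 -> W) : 'rV[R]_3 -> W :=
  foldr (fun u g => fun x => 'D_u g x) f us.

Definition smooth_on (R : realType) (W : normedModType R)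
    (U : set 'rV[R]_3) (f : 'rV[R]_3 -> W) : Prop :=
  forall us x, U x ->
    {for x, continuous (iter_derive us f)} /\
    forall u, derivable (iter_derive us f) x u.

Record closed_oriented_3manifold (R : realType) := Closed3Manifold {
  points :> topologicalType ;
  chart : Type ;
  dom : chart -> set points ;
  coord : chart -> points -> 'rV[R]_3 ;
  param : chart -> 'rV[R]_3 -> points ;
  img := fun i => coord i @` dom i ;
  transition := fun i j => coord j \o param i ;
  overlap := fun i j => coord i @` (dom i `&` dom j) ;
  points_compact : compact [set: points] ;
  points_hausdorff : hausdorff_space points ;
  dom_open : forall i, open (dom i) ;
  dom_cover : \bigcup_i dom i = [set: points] ;
  img_open : forall i, open (img i) ;
  coord_continuous : forall i, {within dom i, continuous (coord i)} ;
  param_continuous : forall i, {within img i, continuous (param i)} ;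
  coordK : forall i x, dom i x -> param i (coord i x) = x ;
  transition_smooth : forall i j, smooth_on (overlap i j) (transition i j) ;
  transition_oriented :
    forall i j x, overlap i j x -> 0 < \det ('J (transition i j) x) }.

(* [w i x [:: v1; ...; vd]] is the value at (v1, ..., vd) of the degree d
   component at x of the expression of w in the chart i; forms are thus
   inhomogeneous.  Local expressions are set to 0 off the image of the chart so
   that equal forms are equal functions. *)
Definition is_form (R : realType) (M : closed_oriented_3manifold R)
    (w : chart M -> 'rV[R]_3 -> seq 'rV[R]_3 -> R) : Prop :=
  [/\ forall i x vs, ~ img i x -> w i x vs = 0,
      forall i x (a : R) u v s1 s2,
        w i x (s1 ++ (a *: u + v) :: s2) =
        a * w i x (s1 ++ u :: s2) + w i x (s1 ++ v :: s2),
      forall i x vs, ~~ uniq vs -> w i x vs = 0,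
      forall i vs, smooth_on (img i) (fun x => w i x vs) &
      forall i j x vs, overlap i j x ->
        w i x vs = w j (transition i j x) [seq 'd (transition i j) x v | v <- vs]].

(* V, graded by gr and with its topology, is the de Rham complex of M with the
   C^oo topology (uniform convergence on compact subsets of charts of all
   derivatives of all coefficients). *)
Definition is_de_rham (R : realType) (M : closed_oriented_3manifold R)
    (V : tvsType R) (gr : int -> set V) : Prop :=
  exists w : V -> chart M -> 'rV[R]_3 -> seq 'rV[R]_3 -> R,
    [/\ set_bij [set: V] [set u | is_form u] w,
        forall (a : R) u v i x vs, w (a *: u + v) i x vs = a * w u i x vs + w v i x vs,
        forall d v, gr d v <->
          (forall i x vs, (size vs)%:Z != d -> w v i x vs = 0) &
        forall (F : set_system V) (v : V), Filter F ->
          (F --> v <->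
           forall i (K : set 'rV[R]_3) us vs, compact K -> K `<=` img i ->
             {uniform K, (fun u => iter_derive us (fun x => w u i x vs : R)) @ F -->
                         iter_derive us (fun x => w v i x vs : R)})].

(** ** Cyclic filtered A-infinity algebras of dimension 3 *)

(* deg' x_1 + ... + deg' x_k for a list of pairs (deg x_i, x_i) *)
Definition sdeg (T : Type) (x : seq (int * T)) : int := \sum_(p <- x) (p.1 - 1).

Definition homogeneous (R : realType) (V : tvsType R) (gr : int -> set V)
    (x : seq (int * V)) : Prop :=
  forall p, p \in x -> gr p.1 p.2.

(* [op A beta [:: x1; ...; xk]] is m_{k,beta}(x1, ..., xk); only the values for
   beta in G matter.  The pairing of C^i with C^(3-i) is extended by 0 to the
   other pairs of degrees. *)
Record cyclic_filtered_Ainfty (R : realType) (G : set R) (V : tvsType R) :=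
  CyclicFilteredAinfty {
  grade : int -> set V ;
  pairing : V -> V -> R ;
  op : R -> seq V -> V ;
  gradeP : is_grading grade ;
  pairing_linear_l : forall (a : R) x y z,
    pairing (a *: x + y) z = a * pairing x z + pairing y z ;
  pairing_linear_r : forall (a : R) x y z,
    pairing z (a *: x + y) = a * pairing z x + pairing z y ;
  pairing_degree : forall i j x y,
    grade i x -> grade j y -> i + j != 3 -> pairing x y = 0 ;
  pairing_sym : forall i j x y, grade i x -> grade j y -> i + j = 3 ->
    pairing x y = (-1) ^ (1 + (i - 1) * (j - 1)) * pairing y x ;
  op_multilinear : forall beta (a : R) x y s1 s2, G beta ->
    op beta (s1 ++ (a *: x + y) :: s2) =
    a *: op beta (s1 ++ x :: s2) + op beta (s1 ++ y :: s2) ;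
  (* degree 1 in C[1]: deg' of the value is the sum of the deg' plus 1 *)
  op_degree : forall beta x, G beta -> homogeneous grade x ->
    grade (sdeg x + 2) (op beta (unzip2 x)) ;
  op_00 : op 0 [::] = 0 ;
  op_Ainfty : forall beta x, G beta -> homogeneous grade x ->
    \sum_(i < (size x).+1) \sum_(k2 < (size x - i).+1)
      \sum_(p \in [set p : R * R | [/\ G p.1, G p.2 & p.1 + p.2 = beta]])
        (-1) ^ (sdeg (take i x)) *:
        op p.1 (unzip2 (take i x) ++
                op p.2 (unzip2 (take k2 (drop i x))) ::
                unzip2 (drop (i + k2) x)) = 0 ;
  (* y is the last entry x_k *)
  op_cyclic : forall beta (x : seq (int * V)) (y x0 : int * V),
    G beta -> homogeneous grade (x0 :: rcons x y) ->
    pairing (op beta (rcons (unzip2 x) y.2)) x0.2 =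
    (-1) ^ ((x0.1 - 1) * sdeg (rcons x y)) *
    pairing (op beta (x0.2 :: unzip2 x)) y.2 ;
  (* In the de Rham case the structure maps are continuous for the C^oo
     topology; in the finite dimensional case this is automatic. *)
  space_cases :
    finite_dimensional V \/
    [/\ exists M : closed_oriented_3manifold R, is_de_rham M grade,
        forall beta k, G beta ->
          continuous (fun x : {ptws 'I_k -> V} => op beta [seq x i | i <- enum 'I_k]) &
        continuous (fun z : V * V => pairing z.1 z.2)] }.

(** ** Series in T

   A series sum_i T^(l_i) x_i is encoded by the function sending an exponent to
   its coefficient.  The sums \sum_(_ \in _) below are over infinite index sets,
   but for b in C_+ they have finitely many nonzero terms for each exponent. *)

Section Series.
Variables (R : realType) (G : set R) (V : tvsType R).
Variable A : cyclic_filtered_Ainfty G V.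

(* b is in C_+^1 *)
Definition positive_deg1 (b : R -> V) : Prop :=
  [/\ forall l, b l != 0 -> 0 < l,
      forall e, finite_set [set l | b l != 0 /\ l <= e] &
      forall l, grade A 1 (b l)].

Definition op_T (beta : R) (xs : seq (R -> V)) : R -> V := fun l =>
  \sum_(ls \in [set ls : seq R | size ls = size xs /\ \sum_(e <- ls) e = l])
    op A beta [seq p.1 p.2 | p <- zip xs ls].

Definition pairing_T (x y : R -> V) : R -> R := fun l =>
  \sum_(e \in [set: R]) pairing A (x e) (y (l - e)).

(* Multiplication by T^beta shifts exponents by beta. *)
Definition MC_sum (b : R -> V) : R -> V := fun l =>
  \sum_(p \in [set p : nat * R | G p.2]) op_T p.2 (nseq p.1 b) (l - p.2).

Definition MC (b : R -> V) : Prop :=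
  positive_deg1 b /\ forall l, MC_sum b l = 0.

Definition Psi' (b : R -> V) : R -> R := fun l =>
  \sum_(p \in [set p : nat * R | G p.2])
    (p.1.+1%:R)^-1 * pairing_T (op_T p.2 (nseq p.1 b)) b (l - p.2).

(* class C^1 on [0, 1], with one-sided derivatives at the end points *)
Definition C1_01 (f : R -> V) : Prop :=
  exists df : R -> V, {within `[0, 1], continuous df} /\
    forall t, 0 <= t <= 1 ->
      (s - t)^-1 *: (f s - f t) @[s --> within `[0, 1] t^'] --> df t.

Definition C1_map (b : R -> R -> V) : Prop :=
  exists (lam : nat -> R) (c : nat -> R -> V),
    [/\ forall i, 0 < lam i,
        lam @ \oo --> +oo,
        forall i t, 0 <= t <= 1 -> grade A 1 (c i t),
        forall i, C1_01 (c i) &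
        forall t, 0 <= t <= 1 ->
          forall l, b t l = \sum_(i \in [set i | lam i = l]) c i t].

End Series.

(* Main.v *)
(** Write phi_beta (x_0, ..., x_k) for the pairing of m_{k,beta} (x_1, ..., x_k)
    with x_0.  It is multilinear and, on elements of degree 1 (deg' = 0), invariant
    under cyclic rotation, so the k+1 terms of the Leibniz rule for
    phi_beta (b, ..., b) / (k+1) all become phi_beta (b', b, ..., b) and
    d/dt Psi'(b) = <\sum T^E(beta) m_{k,beta} (b, ..., b), b'> = 0 by the
    Maurer-Cartan equation.

    Coefficientwise, the coefficient of T^l in Psi'(b) is a finite sum over
    (k, beta) and over the words of length k+1 in the finitely many exponents
    of b up to l; rotating a word permutes the words of a given sum. *)
From Stdlib Require List.
From HB Require Import structures.
Require Import Defs.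
From mathcomp Require Import all_boot all_order all_algebra.
From mathcomp Require Import all_classical all_reals all_analysis.

Local Open Scope ring_scope.

Section CyclicInvariant.

Set Implicit Arguments.
Unset Strict Implicit.
Unset Printing Implicit Defensive.

Import Order.TTheory GRing.Theory Num.Theory.
Import numFieldNormedType.Exports.
Local Open Scope classical_set_scope.
Local Open Scope ring_scope.

(** The list [r] may exceed the support. One list can therefore index the sums attached to all times
    [t], which is needed to differentiate them term by term. *)
Lemma fsbig_support (T : choiceType) (W : nmodType) (P : set T) (r : seq T)
    (F : T -> W) :
  uniq r -> (forall x, P x -> F x != 0 -> x \in r) ->
  \sum_(x \in P) F x = \sum_(x <- r | `[< P x >]) F x.
Proof.
move=> ur supp; rewrite (fsbigE [seq x <- r | `[< P x >]]).
- rewrite big_filter_cond; apply: eq_bigl => x.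
  by case: asboolP => [Px|//] /=; rewrite mem_set.
- exact: filter_uniq.
- by move=> x /=; rewrite mem_filter => /andP[/asboolP].
- move=> x Px; apply: contraNeq => /(supp _ Px) xr.
  by rewrite mem_filter xr andbT; apply/asboolP.
Qed.

(** * Words in a finite alphabet of exponents *)

Section Words.
Variable T : eqType.
Variable E : seq T.

Fixpoint words (n : nat) : seq (seq T) :=
  if n is n'.+1 then [seq x :: w | x <- E, w <- words n'] else [:: [::]].

Lemma mem_words n w : (w \in words n) = (size w == n) && all [in E] w.
Proof.
elim: n w => [|n IHn] [|x w] //=.
  by apply/allpairsP => -[[]] /= ? ? [].
rewrite eqSS [in RHS]andbCA -IHn; apply/allpairsP/andP => [[[y u] /= [yE uw [-> ->]]]|[xE ww]] //.
by exists (x, w).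
Qed.

Lemma words_uniq n : uniq E -> uniq (words n).
Proof.
move=> uE; elim: n => //= n IHn; apply: allpairs_uniq => //.
by move=> [x w] [y u] _ _ [-> ->].
Qed.

(** Rotation permutes the words of a given length. With [P] fixing the sum of the letters, this
    identifies the summed Leibniz terms for the different positions of the derivative. *)
Lemma big_words_rot (W : nmodType) (P : pred (seq T)) (F : seq T -> W) n j :
  uniq E -> (forall w, P (rot j w) = P w) ->
  \sum_(w <- words n | P w) F (rot j w) = \sum_(w <- words n | P w) F w.
Proof.
move=> uE Prot.
have pw : perm_eq [seq rot j w | w <- words n] (words n).
  have umap : uniq [seq rot j w | w <- words n].
    by rewrite map_inj_uniq ?words_uniq//; exact: rot_inj.
  apply: uniq_perm => //; first exact: words_uniq.
  have mem_rotw w : (rot j w \in words n) = (w \in words n).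
    by rewrite !mem_words size_rot; congr (_ && _); apply: eq_all_r; exact: mem_rot.
  move=> w; apply/mapP/idP => [[u uw ->]|ww]; first by rewrite mem_rotw.
  by exists (rotr j w); rewrite ?rotrK// -mem_rotw rotrK.
by rewrite -[RHS](perm_big _ pw) big_map; apply: eq_bigl => w; rewrite Prot.
Qed.

End Words.

Lemma le_sum_of_pos (R : realType) (w : seq R) :
  all (> 0) w -> 0 <= \sum_(x <- w) x /\ forall x, x \in w -> x <= \sum_(y <- w) y.
Proof.
elim: w => [|y w IHw] /=; first by rewrite big_nil.
case/andP => y0 /IHw[s0 le_s]; rewrite big_cons; split.
  by rewrite addr_ge0// ltW.
move=> x; rewrite inE => /predU1P[->|xw]; first by rewrite lerDl.
by rewrite (le_trans (le_s _ xw))// lerDr ltW.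
Qed.

(** * Multilinear forms on lists *)

Section Multilinear.
Variables (R : realType) (V : lmodType R).

Definition multilinear (phi : seq V -> R) : Prop :=
  forall (a : R) x y s1 s2,
    phi (s1 ++ (a *: x + y) :: s2) = a * phi (s1 ++ x :: s2) + phi (s1 ++ y :: s2).

Variable phi : seq V -> R.
Hypothesis phi_lin : multilinear phi.

Lemma multilinear0 s1 s2 : phi (s1 ++ 0 :: s2) = 0.
Proof.
have := phi_lin 1 0 0 s1 s2; rewrite scaler0 addr0 mul1r => /eqP.
by rewrite -subr_eq subrr eq_sym => /eqP.
Qed.

Lemma multilinearZ a x s1 s2 : phi (s1 ++ a *: x :: s2) = a * phi (s1 ++ x :: s2).
Proof. by have := phi_lin a x 0 s1 s2; rewrite multilinear0 !addr0. Qed.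

Lemma multilinearB x y s1 s2 :
  phi (s1 ++ (x - y) :: s2) = phi (s1 ++ x :: s2) - phi (s1 ++ y :: s2).
Proof.
by have := phi_lin (- 1) y x s1 s2; rewrite scaleN1r mulN1r addrC [RHS]addrC.
Qed.

Lemma multilinear_sum (I : Type) (r : seq I) (c : I -> R) (e : I -> V) s1 s2 :
  phi (s1 ++ (\sum_(i <- r) c i *: e i) :: s2) =
  \sum_(i <- r) c i * phi (s1 ++ e i :: s2).
Proof.
elim: r => [|i r IHr]; first by rewrite !big_nil multilinear0.
by rewrite !big_cons phi_lin IHr.
Qed.

(** Discrete Leibniz rule: the entries change from [f] to [g] one at a time from the left, and each
    change contributes one difference. *)
Lemma multilinear_telescope (T : eqType) (f g : T -> V) (x0 : T) (w : seq T) :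
  phi (map f w) - phi (map g w) =
  \sum_(j < size w)
    phi (map g (take j w) ++ (f (nth x0 w j) - g (nth x0 w j)) :: map f (drop j.+1 w)).
Proof.
(* The hybrid whose first [j] entries use [g] and the others [f]. The sign makes the telescoping sum
   run from [g] back to [f]. *)
pose h j := - phi (map g (take j w) ++ map f (drop j w)).
transitivity (h (size w) - h 0%N).
  by rewrite /h take_size drop_size drop0 take0 cats0 /= opprK addrC.
rewrite -telescope_sumr// big_mkord; apply: eq_bigr => j _.
rewrite multilinearB /h opprK addrC (drop_nth x0)//=; congr (_ - phi _).
by rewrite (take_nth x0)// map_rcons cat_rcons.
Qed.

End Multilinear.

(** * Cyclic forms and their rotation invariance *)

Section CyclicForm.
Variables (R : realType) (G : set R) (V : tvsType R).
Variable A : cyclic_filtered_Ainfty G V.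

(* The element paired with m_{k,beta} is put first, so that op_cyclic becomes
   rotation invariance; the value on the empty list is junk. *)
Definition cyclic_form (beta : R) (xs : seq V) : R :=
  if xs is x0 :: xs' then pairing A (op A beta xs') x0 else 0.

Lemma pairing0l x : pairing A 0 x = 0.
Proof.
have := pairing_linear_l A 1 0 0 x; rewrite scaler0 addr0 mul1r => /eqP.
by rewrite -subr_eq subrr eq_sym => /eqP.
Qed.

Lemma pairing0r x : pairing A x 0 = 0.
Proof.
have := pairing_linear_r A 1 0 0 x; rewrite scaler0 addr0 mul1r => /eqP.
by rewrite -subr_eq subrr eq_sym => /eqP.
Qed.

Lemma pairing_suml (I : Type) (r : seq I) (P : pred I) (F : I -> V) x :
  pairing A (\sum_(i <- r | P i) F i) x = \sum_(i <- r | P i) pairing A (F i) x.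
Proof.
apply: (big_morph (pairing A ^~ x)) => [u v|]; last exact: pairing0l.
by have := pairing_linear_l A 1 u v x; rewrite scale1r mul1r.
Qed.

Lemma cyclic_form_multilinear beta : G beta -> multilinear (cyclic_form beta).
Proof.
move=> Gb a x y [|x0 s1] s2 /=; first exact: pairing_linear_r.
by rewrite op_multilinear// pairing_linear_l.
Qed.

Lemma op_eq0 beta s : G beta -> 0 \in s -> op A beta s = 0.
Proof.
move=> Gb /path.splitPr[s1 s2].
have := op_multilinear A 1 0 0 s1 s2 Gb; rewrite scaler0 addr0 scale1r => /eqP.
by rewrite -subr_eq subrr eq_sym => /eqP.
Qed.

Lemma cyclic_form_rot1 beta x s : G beta ->
  (forall y, y \in x :: s -> grade A 1 y) ->
  cyclic_form beta (rcons s x) = cyclic_form beta (x :: s).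
Proof.
case: s => [//|x0 s] Gb gr /=.
have homog : homogeneous (grade A) ((1, x0) :: rcons (map (pair 1) s) (1, x)).
  move=> p; rewrite inE mem_rcons inE => /or3P[/eqP->|/eqP->|] /=.
  - by apply: gr; rewrite !inE eqxx orbT.
  - by apply: gr; rewrite inE eqxx.
  - by case/mapP => y ys -> /=; apply: gr; rewrite !inE ys !orbT.
have := op_cyclic Gb homog.
(* Degree 1 means shifted degree 0, so the exponent of the cyclic sign vanishes. *)
rewrite /= subrr mul0r expr0z mul1r.
suff -> : unzip2 (map (pair (1 : int)) s) = s by [].
by rewrite /unzip2 -map_comp map_id.
Qed.

Lemma cyclic_form_catC beta s1 s2 : G beta ->
  (forall y, y \in s1 ++ s2 -> grade A 1 y) ->
  cyclic_form beta (s1 ++ s2) = cyclic_form beta (s2 ++ s1).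
Proof.
move=> Gb; elim: s1 s2 => [|x s1 IHs] s2 gr; first by rewrite cats0.
rewrite cat_cons -cyclic_form_rot1// -cats1 -catA IHs -?catA//.
by move=> y; rewrite !(mem_cat, inE) => /or3P[] yin; apply: gr;
  rewrite !(mem_cat, inE) yin ?orbT.
Qed.

End CyclicForm.

(** * Coefficients of the series as finite sums over words *)

Section WordExpansion.
Variables (R : realType) (G : set R) (V : tvsType R).
Variable A : cyclic_filtered_Ainfty G V.
Hypothesis GP : discrete_submonoid G.
(** These lists are fixed before [b], so they can serve for every time at once. [E] has to contain
    the exponents of [b] up to [l], and [r] the pairs (k, beta) that can contribute at energy at
    most [l]. *)
Variables (l : R) (E : seq R) (r : seq (nat * R)).
Hypothesis uE : uniq E.
Hypothesis E_pos : forall x, x \in E -> 0 < x.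
Hypothesis ur : uniq r.
Hypothesis r_full : forall (p : nat * R) w, G p.2 -> p.2 <= l ->
  w \in words E p.1 -> \sum_(x <- w) x <= l -> p \in r.

Lemma words_pos n w : w \in words E n -> all (> 0) w.
Proof. by rewrite mem_words => /andP[_ /allP wE]; apply/allP => x /wE; apply: E_pos. Qed.

Lemma words_sum_ge0 n w : w \in words E n -> 0 <= \sum_(x <- w) x.
Proof. by move=> /words_pos/le_sum_of_pos[]. Qed.

Variable b : R -> V.
Hypothesis b_pos : forall x, b x != 0 -> 0 < x.
Hypothesis bE : forall x, b x != 0 -> x <= l -> x \in E.

Lemma op_T_words beta k e : G beta -> e <= l ->
  op_T A beta (nseq k b) e =
  \sum_(w <- words E k | \sum_(x <- w) x == e) op A beta (map b w).
Proof.
move=> Gb le_el; rewrite /op_T (fsbig_support (r := words E k)).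
- rewrite big_seq_cond [RHS]big_seq_cond.
  rewrite [LHS](eq_bigl (fun w => (w \in words E k) && (\sum_(x <- w) x == e))).
    apply: eq_bigr => w /andP[]; rewrite mem_words => /andP[/eqP sw _] _.
    congr (op A beta _); rewrite -{}sw.
    by elim: w => //= x w ->.
  move=> w; case: (boolP (w \in words E k)) => //=.
  rewrite mem_words size_nseq => /andP[/eqP sw _].
  by apply/asboolP/eqP => [[]|].
- exact: words_uniq.
move=> w [sw we] nz; rewrite mem_words sw size_nseq eqxx /=.
have bw0 x : x \in w -> b x != 0.
  move=> xw; apply: contraNneq nz => bx0; apply/eqP/op_eq0 => //.
  apply/mapP; exists (b, x) => //=.
  move: sw xw; rewrite size_nseq => <-; elim: (w) => //= y s IHs.
  rewrite !inE => /predU1P[->|/IHs->]; first by rewrite eqxx.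
  by rewrite orbT.
(* All letters are positive, so each is at most the sum [e], hence at most [l], and lies in [E]. *)
have [_ le_w] : 0 <= \sum_(x <- w) x /\ forall x, x \in w -> x <= \sum_(y <- w) y.
  by apply: le_sum_of_pos; apply/allP => x /bw0; exact: b_pos.
apply/allP => x xw; apply: bE; first exact: bw0.
by rewrite (le_trans _ le_el)// -we le_w.
Qed.

Lemma big_words_cons (W : nmodType) n (e : R) (F : seq R -> W) :
  \sum_(w <- words E n.+1 | \sum_(x <- w) x == e) F w =
  \sum_(y <- E) \sum_(w <- words E n | \sum_(x <- w) x == e - y) F (y :: w).
Proof.
rewrite big_mkcond /= big_allpairs_dep; apply: eq_bigr => y _.
rewrite [RHS]big_mkcond; apply: eq_bigr => w _.
by rewrite big_cons [in RHS]eq_sym subr_eq [in RHS]addrC [in RHS]eq_sym.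
Qed.

(** The exponent of the paired copy of [b] becomes the first letter, so words of length k become
    words of length k+1 with the same status for all letters. *)
Lemma pairing_T_words beta k e : G beta -> e <= l ->
  pairing_T A (op_T A beta (nseq k b)) b e =
  \sum_(w <- words E k.+1 | \sum_(x <- w) x == e) cyclic_form A beta (map b w).
Proof.
move=> Gb le_el; rewrite /pairing_T big_words_cons.
rewrite (fsbig_support (r := [seq e - y | y <- E])).
- rewrite big_map big_mkcond big_seq_cond [RHS]big_seq_cond /=.
  apply: eq_bigr => y /andP[yE _]; rewrite asboolT// op_T_words//.
    by rewrite pairing_suml subKr.
  by rewrite (le_trans _ le_el)// gerBl ltW// E_pos.
- by rewrite map_inj_uniq// => x y /addrI/oppr_inj.
move=> d _ nz; apply/mapP; exists (e - d); last by rewrite subKr.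
have bed : b (e - d) != 0 by apply: contraNneq nz => ->; rewrite pairing0r.
have od : op_T A beta (nseq k b) d != 0.
  by apply: contraNneq nz => ->; rewrite pairing0l.
apply: bE => //; rewrite (le_trans _ le_el)// gerBl.
have led : d <= l by rewrite (le_trans _ le_el)// -subr_ge0 ltW// b_pos.
(* A negative [d] is not the sum of a word of positive letters, so the corresponding coefficient of
   [op_T] would vanish. *)
rewrite leNgt; apply/negP => d0; case/eqP: od; rewrite op_T_words//.
rewrite big_seq_cond big1// => w /andP[/words_sum_ge0 w0 /eqP we].
by move: d0; rewrite -we ltNge w0.
Qed.

Lemma Psi'_words :
  Psi' A b l =
  \sum_(p <- r | `[< G p.2 >]) (p.1.+1%:R)^-1 *
    \sum_(w <- words E p.1.+1 | \sum_(x <- w) x == l - p.2)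
      cyclic_form A p.2 (map b w).
Proof.
have [_ _ G_ge0 _] := GP.
rewrite /Psi' (fsbig_support ur).
  apply: eq_bigr => -[k beta] /= /asboolP Gb.
  by rewrite pairing_T_words// gerBl G_ge0.
move=> [k beta] /= Gb; rewrite mulf_eq0 negb_or => /andP[_].
rewrite pairing_T_words ?gerBl ?G_ge0// => nz.
have /hasP[w ww /eqP wl] : has (fun w => \sum_(x <- w) x == l - beta) (words E k.+1).
  apply: contraNT nz => /hasPn no; rewrite big_seq_cond big1// => w /andP[/no ww].
  by rewrite (negbTE ww).
have := words_sum_ge0 ww; rewrite wl subr_ge0 => le_bl.
(* [r_full] speaks of words of length k, whereas the word found has length k+1. Dropping its
   positive first letter only lowers the sum. *)
case/allpairsP: ww => -[y u] /= [yE uu wE]; apply: (r_full (w := u)) => //=.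
have : \sum_(x <- w) x <= l by rewrite wl gerBl G_ge0.
by rewrite wE big_cons; apply: le_trans; rewrite lerDr ltW// E_pos.
Qed.

Lemma MC_sum_words e : e <= l ->
  MC_sum A b e =
  \sum_(p <- r | `[< G p.2 >])
    \sum_(w <- words E p.1 | \sum_(x <- w) x == e - p.2) op A p.2 (map b w).
Proof.
have [_ _ G_ge0 _] := GP; move=> le_el.
have le_l beta : G beta -> e - beta <= l.
  by move=> /G_ge0 b0; rewrite (le_trans _ le_el)// gerBl.
rewrite /MC_sum (fsbig_support ur).
  by apply: eq_bigr => -[k beta] /= /asboolP Gb; rewrite op_T_words// le_l.
move=> [k beta] /= Gb; rewrite op_T_words ?le_l// => nz.
have /hasP[w ww /eqP we] : has (fun w => \sum_(x <- w) x == e - beta) (words E k).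
  apply: contraNT nz => /hasPn no; rewrite big_seq_cond big1// => w /andP[/no ww].
  by rewrite (negbTE ww).
have := words_sum_ge0 ww; rewrite we subr_ge0 => le_be.
by apply: (r_full (w := w)) => //=; [exact: le_trans le_be le_el|rewrite we le_l].
Qed.

(** Grouping by the first letter [y] leaves, over all (k, beta), exactly the words that make up the
    coefficient of the Maurer-Cartan sum at [l - y]. *)
Lemma pairing_MC_words (v : R -> V) :
  \sum_(p <- r | `[< G p.2 >])
    \sum_(w <- words E p.1.+1 | \sum_(x <- w) x == l - p.2)
      cyclic_form A p.2 (v (head 0 w) :: map b (behead w)) =
  \sum_(y <- E) pairing A (MC_sum A b (l - y)) (v y).
Proof.
transitivity (\sum_(p <- r | `[< G p.2 >]) \sum_(y <- E)
    \sum_(w <- words E p.1 | \sum_(x <- w) x == (l - y) - p.2)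
      pairing A (op A p.2 (map b w)) (v y)).
  apply: eq_bigr => p _; rewrite big_words_cons; apply: eq_bigr => y _.
  by apply: eq_bigl => w; rewrite addrAC.
rewrite exchange_big /= big_seq_cond [RHS]big_seq_cond.
apply: eq_bigr => y /andP[yE _]; rewrite MC_sum_words ?gerBl ?ltW ?E_pos//.
by rewrite pairing_suml; apply: eq_bigr => p _; rewrite pairing_suml.
Qed.

End WordExpansion.

(** * Limits of forms and of difference quotients *)

Section Continuity.
Variables (R : realType) (V : tvsType R).

Lemma multilinear_cvg (phi : seq V -> R) (T : Type) (F : set_system T)
    (L : seq ((T -> V) * V)) :
  finite_dimensional V -> multilinear phi -> Filter F ->
  List.Forall (fun p => p.1 x @[x --> F] --> p.2) L ->
  phi [seq p.1 x | p <- L] @[x --> F] --> phi [seq p.2 | p <- L].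
Proof.
move=> [n [f [g [f_lin fK gK _ g_cont]]]] phi_lin FF cvgL.
pose e i := f (delta_mx 0 i).
have coordE (y : V) : y = \sum_(i < n) g y 0 i *: e i.
  pose f' : {linear 'rV[R]_n -> V} :=
    HB.pack f (GRing.isLinear.Build _ _ _ _ f f_lin).
  rewrite -{1}[y]gK {1}[g y]row_sum_delta -[f _]/(f' _) linear_sum.
  by apply: eq_bigr => i _; rewrite linearZ.
(* The constant prefix [s] makes the induction work: once an entry is expanded in the basis, the
   basis vector joins the prefix and only scalar coordinates still vary. *)
suff gen s : phi (s ++ [seq p.1 x | p <- L]) @[x --> F] --> phi (s ++ [seq p.2 | p <- L]).
  exact: (gen [::]).
elim: cvgL s => [|[h y] L' /= hy _ IH] s; first exact: cvg_cst.
under eq_cvg do rewrite [h _]coordE multilinear_sum//.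
rewrite [y]coordE multilinear_sum//.
apply: (@cvg_big _ _ _ _ _ add_continuous) => i _.
apply: cvgM.
  apply: (cvg_comp (fun x => g (h x)) (fun M : 'rV[R]_n => M 0 i));
    last exact: (@coord_continuous R 1 n 0 i (g y)).
  by apply: (cvg_comp h g _ (g_cont y)); exact: hy.
by under eq_cvg do rewrite -cat_rcons; rewrite -cat_rcons; exact: IH.
Qed.

Lemma Forall_nth (T : Type) (P : T -> Prop) (L : seq T) (d : T) i :
  List.Forall P L -> (i < size L)%N -> P (nth d L i).
Proof. by move=> PL; elim: PL i => // x L' Px _ IH [|i] //=; exact: IH. Qed.

Lemma cyclic_form_cvg (G : set R) (A : cyclic_filtered_Ainfty G V) beta
    (T : Type) (F : set_system T) (L : seq ((T -> V) * V)) :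
  G beta -> Filter F ->
  List.Forall (fun p => p.1 x @[x --> F] --> p.2) L ->
  cyclic_form A beta [seq p.1 x | p <- L] @[x --> F] -->
  cyclic_form A beta [seq p.2 | p <- L].
Proof.
move=> Gb FF cvgL; case: (space_cases A) => [fin|[_ op_cont pair_cont]].
  exact: multilinear_cvg (cyclic_form_multilinear A Gb) _ cvgL.
case: L cvgL => [|p L] cvgL; first exact: cvg_cst.
have [cvgp cvgL'] : p.1 x @[x --> F] --> p.2 /\
    List.Forall (fun q => q.1 x @[x --> F] --> q.2) L by inversion cvgL.
suff cvg_op : op A beta [seq q.1 x | q <- L] @[x --> F] --> op A beta [seq q.2 | q <- L].
  apply: (cvg_comp (fun x => (op A beta [seq q.1 x | q <- L], p.1 x))
    (fun z : V * V => pairing A z.1 z.2)); last exact: (pair_cont (op A beta [seq q.2 | q <- L], p.2)).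
  exact: cvg_pair.
pose d : (T -> V) * V := (cst 0, 0).
(* Continuity of [op] is stated for functions on ['I_k] with the pointwise topology, so lists are
   rewritten as enumerations of such functions. *)
have E (h : (T -> V) * V -> V) :
    [seq h q | q <- L] = [seq h (nth d L (i : 'I_(size L))) | i <- enum 'I_(size L)].
  rewrite -[in LHS](mkseq_nth d L) /mkseq -val_enum_ord -!map_comp.
  by [].
under eq_cvg do rewrite E; rewrite E.
pose u x : {ptws 'I_(size L) -> V} := fun i => (nth d L i).1 x.
pose u0 : {ptws 'I_(size L) -> V} := fun i => (nth d L i).2.
apply: (cvg_comp u (fun z : {ptws 'I_(size L) -> V} =>
  op A beta [seq z i | i <- enum 'I_(size L)])); last exact: (op_cont _ _ Gb u0).
apply/cvg_sup => i N [_ [[W oW <-]] Wu0 WN] /=.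
apply: filterS WN _.
apply: (Forall_nth d cvgL' (ltn_ord i)).
exact: open_nbhs_nbhs.
Qed.

(** [f s] is [(s - t)] times the quotient plus [f t], and the first summand tends to 0. An arbitrary
    filter covers the one-sided limits at the end points. *)
Lemma quotient_cvg (F : set_system R) (t : R) (f : R -> V) (v : V) :
  Filter F -> F --> t -> F [set s | s != t] ->
  (s - t)^-1 *: (f s - f t) @[s --> F] --> v -> f s @[s --> F] --> f t.
Proof.
move=> FF Ft Fneq fv.
have st : (s - t : R^o) @[s --> F] --> (0 : R^o).
  by rewrite -(subrr t); apply: cvgB => //; exact: cvg_cst.
have sv : (s - t) *: ((s - t)^-1 *: (f s - f t)) @[s --> F] --> 0 *: v.
  apply: (cvg_comp (fun s => (s - t : R^o, (s - t)^-1 *: (f s - f t)))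
    (fun z : R^o * V => z.1 *: z.2)); last exact: (scale_continuous (0, v)).
  exact: (cvg_pair st fv).
have sv' : (s - t) *: ((s - t)^-1 *: (f s - f t)) + f t @[s --> F] --> 0 *: v + f t.
  apply: (cvg_comp (fun s => ((s - t) *: ((s - t)^-1 *: (f s - f t)), f t))
    (fun z : V * V => z.1 + z.2)); last exact: (add_continuous (0 *: v, f t)).
  by apply: cvg_pair => //; exact: cvg_cst.
rewrite scale0r add0r in sv'.
apply: cvg_trans sv'; apply: near_eq_cvg.
apply: filterS Fneq => s /= st0.
by rewrite scalerA divff ?subr_eq0// scale1r subrK.
Qed.

End Continuity.

(** The mean value theorem with derivative 0: the limits at the end points enter only through
    continuity on the closed interval. *)
Lemma quotient0_endpoints (R : realType) (f : R -> R) :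
  (forall t, 0 <= t <= 1 ->
    (s - t)^-1 * (f s - f t) @[s --> within `[0, 1] t^'] --> 0) ->
  f 0 = f 1.
Proof.
move=> f0.
suff df (x : R) : x \in `]0, 1[ -> is_derive x (1 : R) f (0 : R).
  have f_cont : {within `[0, 1], continuous f}.
    apply/subspace_continuousP => x /=; rewrite in_itv /= => x01.
    have cvgx : f s @[s --> within `[0, 1] x^'] --> f x.
      apply: (@quotient_cvg R R^o _ x f 0); last exact: f0.
      - by apply: (cvg_trans (cvg_within _)); exact: cvg_within.
      - by rewrite /within /=; near=> s => _; near: s; exact: nbhs_dnbhs_neq.
    move=> U Ux.
    have Uf : nbhs x (fun y => y != x -> y \in `[0, 1] -> U (f y)) := cvgx U Ux.
    suff : nbhs x (fun y => y \in `[0, 1] -> U (f y)) by [].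
    apply: filterS Uf => y Uy y01.
    (* The punctured limit says nothing at [y = x], but there the value is [f x], which lies in
       [U]. *)
    by have [->|yx] := eqVneq y x; [exact: nbhs_singleton|exact: Uy].
  have [c _] := @MVT R f (cst 0) 0 1 ltr01 df f_cont.
  by rewrite /= mul0r => /eqP; rewrite subr_eq0 => /eqP.
  rewrite in_itv /= => /andP[x0 x1].
  (* At an interior point the restriction to the closed interval is void near [x]; the substitution
     [s = h + x] then gives the two-sided derivative. *)
  have cvg0 : h^-1 *: (f (h *: 1 + x) - f x) @[h --> 0^'] --> 0.
    have /f0 fx : 0 <= x <= 1 by rewrite !ltW.
    apply: (@cvg_trans _ (((s - x)^-1 * (f s - f x)) @[s --> within `[0, 1] x^'])) => //.
    move=> U xU.
    have xU' : nbhs x (fun y => y != x -> U ((y - x)^-1 * (f y - f x))).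
      have Uf : nbhs x (fun y => y != x -> y \in `[0, 1] -> U ((y - x)^-1 * (f y - f x))) := xU.
      have x01 : nbhs x (fun y => y \in `]0, 1[).
        by apply: near_in_itvoo; rewrite in_itv /= x0.
      apply: filterS2 Uf x01 => y Uy y01 yx; apply: Uy => //=.
      exact: subset_itv_oo_cc y01.
    have sh : h + x @[h --> (0 : R)] --> x.
      by rewrite -{2}[x]add0r; apply: cvgD; [exact: cvg_id|exact: cvg_cst].
    suff : nbhs (0 : R) (fun h => h != 0 -> U (h^-1 *: (f (h *: 1 + x) - f x))) by [].
    have Us : nbhs (0 : R) (fun h => h + x != x ->
        U ((h + x - x)^-1 * (f (h + x) - f x))) := sh _ xU'.
    apply: filterS Us => h /= Uh h0.
    have := Uh; rewrite -subr_eq0 addrK => /(_ h0).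
    by rewrite /GRing.scale /= mulr1.
  apply: DeriveDef; first by apply/cvg_ex; exists 0.
  exact: cvg_lim.
Unshelve. all: by end_near.
Qed.

(** * Leibniz rule for the cyclic forms *)

Section Derivative.
Variables (R : realType) (G : set R) (V : tvsType R).
Variable A : cyclic_filtered_Ainfty G V.
Variables (F : set_system R) (t : R) (b : R -> R -> V) (v : R -> V).
Context {FF : Filter F}.
Hypothesis Ft : F --> t.
Hypothesis Fneq : F [set s | s != t].
Hypothesis gr_t : forall x, grade A 1 (b t x).
Hypothesis gr_F : F [set s | forall x, grade A 1 (b s x)].
Hypothesis bv : forall x, (s - t)^-1 *: (b s x - b t x) @[s --> F] --> v x.

Lemma grade1B x y : grade A 1 x -> grade A 1 y -> grade A 1 (x - y).
Proof.
have [/(_ 1)[_ gr] _] := gradeP A; move=> gx gy.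
by have := gr (-1) y x gy gx; rewrite scaleN1r addrC.
Qed.

(* Cyclicity moves each varying entry to the front before the limit is taken,
   so that it is only applied to elements of degree 1. *)
Lemma cyclic_form_derive beta (w : seq R) : G beta ->
  (s - t)^-1 * (cyclic_form A beta (map (b s) w) - cyclic_form A beta (map (b t) w))
    @[s --> F] -->
  \sum_(j < size w)
    cyclic_form A beta (v (head 0 (rot j w)) :: map (b t) (behead (rot j w))).
Proof.
move=> Gb; have lin := cyclic_form_multilinear A Gb.
have rotE (j : 'I_(size w)) :
    rot j w = nth 0 w j :: drop j.+1 w ++ take j w.
  by rewrite /rot (drop_nth 0).
(* The [j]-th telescoping term after rotation: the difference quotient in front, then the later
   letters at time [s] and the earlier ones at time [t]. *)
pose q s (j : 'I_(size w)) := cyclic_form A beta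
  ((s - t)^-1 *: (b s (nth 0 w j) - b t (nth 0 w j)) ::
   map (b s) (drop j.+1 w) ++ map (b t) (take j w)).
apply: (@cvg_trans _ (\sum_(j < size w) q s j @[s --> F])).
  apply: near_eq_cvg; near=> s.
  have gr_s : forall x, grade A 1 (b s x) by near: s.
  rewrite (multilinear_telescope lin _ _ 0) mulr_sumr; apply: eq_bigr => j _; rewrite /q.
  have /= -> := multilinearZ lin (s - t)^-1 (b s (nth 0 w j) - b t (nth 0 w j))
    [::] (map (b s) (drop j.+1 w) ++ map (b t) (take j w)).
  congr (_ * _).
  rewrite cyclic_form_catC// => y; rewrite mem_cat inE.
  by case/or3P => [/mapP[z _ ->]|/eqP->|/mapP[z _ ->]] //; exact: grade1B.
apply: (@cvg_big _ _ _ _ _ add_continuous) => j _; rewrite rotE /= map_cat.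
have bs x : b s x @[s --> F] --> b t x
    by exact: (@quotient_cvg _ _ _ _ (b ^~ x) _ FF Ft Fneq (@bv x)).
pose dq (x : R) s := (s - t)^-1 *: (b s x - b t x).
pose L := (dq (nth 0 w j), v (nth 0 w j)) ::
  [seq (fun s => b s x, b t x) | x <- drop j.+1 w] ++
  [seq (fun=> b t x, b t x) | x <- take j w].
have cvgL : List.Forall (fun p => p.1 x @[x --> F] --> p.2) L.
  apply: List.Forall_cons; first exact: bv.
  apply/List.Forall_app; split.
    by elim: (drop _ _) => //= x u IHu; apply: List.Forall_cons => //=; exact: bs.
  by elim: (take _ _) => //= x u IHu; apply: List.Forall_cons => //=; exact: cvg_cst.
have := cyclic_form_cvg (A := A) Gb FF cvgL.
rewrite /L /= map_cat -!map_comp; under eq_cvg do rewrite map_cat -!map_comp.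
exact.
Unshelve. all: by end_near.
Qed.

(** The derivative has k+1 terms, one for each rotation. Summed over all words they coincide, and
    the factor 1/(k+1) of [Psi'] cancels their number. *)
Lemma big_words_derive (E : seq R) beta k e : uniq E -> G beta ->
  (s - t)^-1 * (k.+1%:R^-1 *
      \sum_(w <- words E k.+1 | \sum_(x <- w) x == e) cyclic_form A beta (map (b s) w) -
    k.+1%:R^-1 *
      \sum_(w <- words E k.+1 | \sum_(x <- w) x == e) cyclic_form A beta (map (b t) w))
    @[s --> F] -->
  \sum_(w <- words E k.+1 | \sum_(x <- w) x == e)
    cyclic_form A beta (v (head 0 w) :: map (b t) (behead w)).
Proof.
move=> uE Gb; under eq_cvg do rewrite -mulrBr mulrCA -sumrB mulr_sumr.
pose h w := cyclic_form A beta (v (head 0 w) :: map (b t) (behead w)).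
have -> : \sum_(w <- words E k.+1 | \sum_(x <- w) x == e) h w =
    k.+1%:R^-1 * \sum_(w <- words E k.+1 | \sum_(x <- w) x == e)
      \sum_(j < size w) h (rot j w).
  transitivity (k.+1%:R^-1 * \sum_(w <- words E k.+1 | \sum_(x <- w) x == e)
      \sum_(j < k.+1) h (rot j w)); last first.
    congr (_ * _); rewrite big_seq_cond [RHS]big_seq_cond.
    by apply: eq_bigr => w /andP[]; rewrite mem_words => /andP[/eqP -> _] _.
  rewrite exchange_big /=.
  have -> : \sum_(j < k.+1) \sum_(w <- words E k.+1 | \sum_(x <- w) x == e) h (rot j w) =
      \sum_(j < k.+1) \sum_(w <- words E k.+1 | \sum_(x <- w) x == e) h w.
    apply: eq_bigr => j _; apply: big_words_rot => // w.
    by rewrite (perm_big w)// perm_rot.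
  by rewrite sumr_const card_ord -[X in _ * X]mulr_natl mulKf// pnatr_eq0.
apply: cvgM; first exact: cvg_cst.
apply: (@cvg_big _ _ _ _ _ add_continuous) => w _.
exact: cyclic_form_derive.
Qed.

End Derivative.

(** * Finiteness below a given energy, and vanishing of the derivative *)

Section Exponents.
Variables (R : realType) (lam : nat -> R).
Hypothesis lam_pos : forall i, 0 < lam i.
Hypothesis lam_oo : lam @ \oo --> +oo.

Lemma exponents_finite (l : R) : finite_set [set i | lam i <= l].
Proof.
have [N _ lamN] : \forall i \near \oo, l < lam i.
  by move/cvgryPgt : lam_oo => /(_ l).
apply: (sub_finite_set _ (finite_II N)) => i /= il.
by rewrite ltnNge; apply/negP => /lamN /=; rewrite ltNge il.
Qed.

Lemma exponents_enum (l : R) : exists E : seq R,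
  [/\ uniq E, forall x, x \in E -> 0 < x &
      forall i, lam i <= l -> lam i \in E].
Proof.
have [s sE] := (finite_seqP _).1 (finite_image lam (exponents_finite l)).
exists (undup s); split; first exact: undup_uniq.
- move=> x; rewrite mem_undup => xs.
  have : [set` s] x by [].
  by rewrite -sE => -[i _ <-].
- move=> i il; rewrite mem_undup; have : [set` s] (lam i) by rewrite -sE; exists i.
  by [].
Qed.

End Exponents.

Lemma words_length_bounded (R : realType) (E : seq R) (l : R) :
  (forall x, x \in E -> 0 < x) ->
  exists N, forall n w, w \in words E n -> \sum_(x <- w) x <= l -> (n < N)%N.
Proof.
move=> E_pos.
have [d d0 dE] : exists2 d : R, 0 < d & forall x, x \in E -> d <= x.
  elim: E E_pos => [|y E IHE] E_pos; first by exists 1.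
  have [|d d0 dE] := IHE; first by move=> x xE; apply: E_pos; rewrite inE xE orbT.
  exists (Num.min y d); first by rewrite lt_min d0 E_pos ?mem_head.
  move=> x; rewrite inE ge_min => /predU1P[->|/dE->]; first by rewrite lexx.
  by rewrite orbT.
(* Every letter is at least [d], so a word of length n has sum at least n times [d], and n is at
   most [l / d]. *)
exists (Num.bound `|l / d|) => n w; rewrite mem_words => /andP[/eqP <- /allP wE] wl.
rewrite -(ltr_nat R); apply: le_lt_trans (archi_boundP (normr_ge0 _)).
apply: le_trans (ler_norm _); rewrite ler_pdivlMr//; apply: le_trans wl.
elim: w wE => [|x w IHw] wE /=; first by rewrite mul0r big_nil.
rewrite big_cons -addn1 natrD mulrDl mul1r addrC lerD//.
  by apply/dE/wE; rewrite mem_head.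
by apply: IHw => y yw; apply: wE; rewrite inE yw orbT.
Qed.

(** Several indices [i] may carry the same exponent, but only finitely many since [lam] tends to
    infinity; the derivative is the finite sum of theirs. *)
Lemma C1_map_quotient (R : realType) (V : tvsType R) (lam : nat -> R)
    (c : nat -> R -> V) (b : R -> R -> V) (t : R) :
  lam @ \oo --> +oo -> (forall i, C1_01 (c i)) ->
  (forall t, 0 <= t <= 1 -> forall l, b t l = \sum_(i \in [set i | lam i = l]) c i t) ->
  0 <= t <= 1 ->
  exists v : R -> V, forall x,
    (s - t)^-1 *: (b s x - b t x) @[s --> within `[0, 1] t^'] --> v x.
Proof.
move=> lam_oo c1 bE t01.
have dc_ex (i : nat) : exists y : V,
    (s - t)^-1 *: (c i s - c i t) @[s --> within `[0, 1] t^'] --> y.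
  by have [df [_ /(_ t t01)]] := c1 i; exists (df t).
have [dc dcE] := choice dc_ex.
have fin x : finite_set [set i | lam i = x].
  by apply: sub_finite_set (exponents_finite lam_oo x) => i /= ->.
exists (fun x => \sum_(i \in [set i | lam i = x]) dc i) => x.
rewrite fsbig_finite//; set r := finmap.enum_fset _.
apply: (@cvg_trans _
  (\sum_(i <- r) (s - t)^-1 *: (c i s - c i t) @[s --> within `[0, 1] t^'])).
  apply: near_eq_cvg; apply: filterS (withinT _ _) => s s01.
  have {}s01 : 0 <= s <= 1 by move: s01; rewrite /= in_itv.
  by rewrite !bE// !fsbig_finite// -/r -scaler_sumr sumrB.
apply: (@cvg_big _ _ _ _ _ add_continuous) => i _; exact: dcE.
Qed.

Lemma Psi'_quotient (R : realType) (G : set R) (V : tvsType R)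
    (A : cyclic_filtered_Ainfty G V) (b : R -> R -> V) (l t : R) :
  discrete_submonoid G ->
  (forall t, 0 <= t <= 1 -> MC A (b t)) ->
  C1_map A b ->
  0 <= t <= 1 ->
  (s - t)^-1 * (Psi' A (b s) l - Psi' A (b t) l) @[s --> within `[0, 1] t^'] --> 0.
Proof.
move=> GP bMC [lam [c [lam_pos lam_oo _ c1 bE]]] t01.
have [E [uE E_pos lamE]] := exponents_enum lam_pos lam_oo l.
have [N EN] := words_length_bounded l E_pos.
have [_ _ _ /(_ l)/finite_seqP[B' B'E]] := GP.
pose B := undup B'.
have BE beta : G beta -> beta <= l -> beta \in B.
  move=> Gb lb; have : [set` B'] beta by rewrite -B'E.
  by rewrite /B mem_undup.
(* Finitely many lengths, as the letters are bounded below by a positive number, and finitely many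
   energies, as [G] is discrete. *)
pose r := [seq (k, beta) | k <- iota 0 N, beta <- B].
have ur : uniq r.
  apply: allpairs_uniq; [exact: iota_uniq|exact: undup_uniq|].
  by move=> [? ?] [? ?] _ _ [-> ->].
have r_full (p : nat * R) w : G p.2 -> p.2 <= l -> w \in words E p.1 ->
    \sum_(x <- w) x <= l -> p \in r.
  move=> Gp pl wp wl; apply/allpairsP; exists p; split; last by case: (p).
    by rewrite mem_iota /= add0n; exact: EN wp wl.
  exact: BE.
have b_pos s : 0 <= s <= 1 -> forall x, b s x != 0 -> 0 < x.
  by move=> /bMC[[]].
have b_supp s : 0 <= s <= 1 -> forall x, b s x != 0 -> x <= l -> x \in E.
  move=> s01 x; rewrite bE// => nz xl.
  have [[i ix]|no] := pselect (exists i, lam i = x); first by rewrite -ix lamE// ix.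
  move: nz; rewrite fsbig1 ?eqxx// => i /= ix.
  by case: no; exists i.
have gr s : 0 <= s <= 1 -> forall x, grade A 1 (b s x) by move=> /bMC[[]].
have [v bv] := C1_map_quotient lam_oo c1 bE t01.
set F := within _ _ in bv *.
have F01 : F [set s | 0 <= s <= 1].
  by apply: filterS (withinT _ _) => s /=; rewrite in_itv.
have Ft : F --> t by apply: (cvg_trans (cvg_within _)); exact: cvg_within.
have Fneq : F [set s | s != t].
  by rewrite /F /within /=; near=> s => _; near: s; exact: nbhs_dnbhs_neq.
have Fgr : F [set s | forall x, grade A 1 (b s x)] by apply: filterS F01 => s /gr.
pose S s (p : nat * R) := p.1.+1%:R^-1 *
  \sum_(w <- words E p.1.+1 | \sum_(x <- w) x == l - p.2) cyclic_form A p.2 (map (b s) w).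
have Psi'E s : 0 <= s <= 1 -> Psi' A (b s) l = \sum_(p <- r | `[< G p.2 >]) S s p.
  by move=> s01; apply: Psi'_words => //; [exact: b_pos|exact: b_supp].
apply: (@cvg_trans _
  (\sum_(p <- r | `[< G p.2 >]) (s - t)^-1 * (S s p - S t p) @[s --> F])).
  apply: near_eq_cvg; apply: filterS F01 => s s01.
  by rewrite !Psi'E// -mulr_sumr sumrB.
have sum0 : \sum_(p <- r | `[< G p.2 >])
    \sum_(w <- words E p.1.+1 | \sum_(x <- w) x == l - p.2)
      cyclic_form A p.2 (v (head 0 w) :: map (b t) (behead w)) = 0.
  (* With the derivatives [v] as first entries, regrouping exhibits the Maurer-Cartan sum of [b t]
     as a factor of every term. *)
  rewrite (pairing_MC_words A GP uE E_pos ur r_full (b_pos t t01) (b_supp t t01)).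
  by rewrite big1// => y _; have [_ ->] := bMC t t01; rewrite pairing0l.
rewrite -[X in _ `=>` nbhs X]sum0.
apply: (@cvg_big _ _ _ _ _ add_continuous) => p /asboolP Gp.
exact: (@big_words_derive R G V A F t b v _ Ft Fneq (gr t t01) Fgr bv E p.2 p.1
  (l - p.2) uE Gp).
Unshelve. all: by end_near.
Qed.

End CyclicInvariant.

Theorem proposition2p3 (R : realType) (G : set R) (V : tvsType R)
    (A : cyclic_filtered_Ainfty G V) (b : R -> R -> V) :
  discrete_submonoid G ->
  (forall t : R, 0 <= t <= 1 -> MC A (b t)) ->
  C1_map A b ->
  Psi' A (b 0) = Psi' A (b 1).
Proof.
move=> GP bMC bC1; apply: functional_extensionality_dep => l.
apply: (@quotient0_endpoints R (fun t => Psi' A (b t) l)) => t t01.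
exact: Psi'_quotient.
Qed.
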